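(* Let $R$ be a finite commutative ring with identity of odd characteristic and let $n$ be a positive integer. Let $\mathcal{P}=\{M_k : 1\le k\le 2n-1\}$ be a partition of the set $X=\{\{i,j\}:1\le i\ne j\le 2n\}$ of unordered pairs such that, for every $k$, $|M_k|=n$ and $\alpha\cap\beta=\emptyset$ for all $\alpha,\beta\in M_k$ with $\alpha\neq\beta$ (that is, a $1$-factorization of the complete graph on $\{1,\dots,2n\}$). Then $\mathfrak{so}_{2n}(R)$ has an ODAC $$\mathfrak{so}_{2n}(R)=H_1\oplus H_2\oplus\cdots\oplus H_{2n-1},$$ where $H_k=\langle X_{(i,j)} : \{i,j\}\in M_k\rangle_R$.
   Context: $X_{(i,j)}=e_{ij}-e_{ji}$, where $e_{ij}$ is the $2n\times 2n$ matrix over $R$ with $1$ in position $(i,j)$ and $0$ elsewhere; $\mathfrak{so}_{2n}(R)=\langle X_{(i,j)} : 1\le i\ne j\le 2n\rangle_R$ with bracket $[A,B]=AB-BA$, and $\langle\cdot\rangle_R$ denotes $R$-span. Let $L$ be a Lie algebra over $R$ that is free of finite rank as an $R$-module. A Cartan subalgebra of $L$ is a nilpotent subalgebra $H$ that equals its normalizer $N_L(H)=\{x\in L:[x,H]\subseteq H\}$. The Killing form is $K(A,B)=\operatorname{Tr}(\operatorname{ad}A\cdot\operatorname{ad}B)$. An ODAC (orthogonal decomposition into abelian Cartan subalgebras) of $L$ is a direct sum decomposition of $R$-modules of $L$ into finitely many abelian Cartan subalgebras that are pairwise orthogonal with respect to the Killing form. *)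

(* Defs.v *)
From HB Require Import structures.
From mathcomp Require Import all_boot all_order all_algebra.
From mathcomp Require Import boolp classical_sets ring.

Set Implicit Arguments.
Unset Strict Implicit.
Unset Printing Implicit Defensive.

Import GRing.Theory VectorInternalTheory.
Local Open Scope ring_scope.
Local Open Scope classical_set_scope.

(* The kernel of the canonical map from the integers to R is generated by c;  *)
(* since 0 divides only 0, c = 0 is the usual convention in the infinite case *)
Definition is_char (R : nzRingType) (c : nat) : Prop :=
  forall m : nat, (m%:R == 0 :> R) = (c %| m)%N.

Definition lspan (R : nzRingType) (V : lmodType R) (S : set V) : set V :=
  [set x | exists2 s : seq (R * V),
     (forall p, p \in s -> S p.2) & x = \sum_(p <- s) p.1 *: p.2].

Section LSpan.
Variables (R : nzRingType) (V : lmodType R) (S : set V).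

Lemma mem_lspan x : S x -> lspan S x.
Proof.
move=> Sx; exists [:: (1, x)]; last by rewrite big_seq1 scale1r.
by move=> p; rewrite inE => /eqP->.
Qed.

Lemma lspan_submod : subsemimod_closed (mem (lspan S)).
Proof.
split; [split|].
- by rewrite in_setE; exists [::]; rewrite ?big_nil.
- move=> x y; rewrite !in_setE => -[s Ss ->] [t St ->].
  exists (s ++ t); last by rewrite big_cat.
  by move=> p; rewrite mem_cat => /orP[/Ss|/St].
- move=> a x; rewrite !in_setE => -[s Ss ->].
  exists [seq (a * p.1, p.2) | p <- s].
    by move=> p /mapP[q /Ss Sq ->].
  by rewrite scaler_sumr big_map; apply: eq_bigr => p _; rewrite scalerA.
Qed.

End LSpan.

(* Lie algebras that are free of finite rank as modules: over an arbitrary    *)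
(* ring, a vectType is a module with a linear bijection onto some 'rV_d.      *)
HB.mixin Record Vector_isLie (R : comNzRingType) (L : Type)
    of Vector R L := {
  lie : L -> L -> L;
  lie_linearl : forall y : L, linear (lie^~ y);
  lie_linearr : forall x : L, linear (lie x);
  liexx : forall x : L, lie x x = 0;
  lie_jacobi : forall x y z : L,
    lie x (lie y z) + lie y (lie z x) + lie z (lie x y) = 0 }.

#[short(type="lieAlgType")]
HB.structure Definition LieAlg (R : comNzRingType) :=
  { L of Vector_isLie R L & Vector R L }.

Section LieTheory.
Variables (R : comNzRingType) (L : lieAlgType R).
Implicit Types (x y : L) (H : set L).

Definition lie_subalgebra H : Prop :=
  submod_closed (mem H) /\ (forall x y, H x -> H y -> H (lie x y)).

Definition lie_abelian H : Prop := forall x y, H x -> H y -> lie x y = 0.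

Fixpoint lower_central H (k : nat) : set L :=
  if k is k'.+1 then lspan [set lie x y | x in H & y in lower_central H k']
  else H.

Definition lie_nilpotent H : Prop :=
  exists k, lower_central H k = [set 0].

Definition lie_normalizer H : set L :=
  [set x | forall h, H h -> H (lie x h)].

Definition is_cartan H : Prop :=
  [/\ lie_subalgebra H, lie_nilpotent H & H = lie_normalizer H].

Definition ad x : 'End(L) := linfun (lie x).

(* f2mx is the matrix of an endomorphism in the basis given by the vectType   *)
(* structure; its trace does not depend on this basis.                        *)
Definition killing x y : R := \tr (f2mx (ad x \o ad y)%VF).

Definition direct_sum_decomposition (d : nat) (H : 'I_d -> set L) : Prop :=
  forall x, exists! h : {ffun 'I_d -> L},
    (forall k, H k (h k)) /\ x = \sum_k h k.

Definition is_ODAC (d : nat) (H : 'I_d -> set L) : Prop :=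
  [/\ direct_sum_decomposition H,
      forall k, is_cartan (H k),
      forall k, lie_abelian (H k)
    & forall k l, k != l -> forall x y, H k x -> H l y -> killing x y = 0].

End LieTheory.

Section SpecialOrthogonal.
Variables (R : comNzRingType) (m : nat).
Implicit Types A B C : 'M[R]_m.

Definition Xmx (i j : 'I_m) : 'M[R]_m := delta_mx i j - delta_mx j i.

Lemma XmxN k l i j : Xmx k l j i = - Xmx k l i j.
Proof.
by rewrite !mxE opprB [(j == k) && _]andbC [(j == l) && _]andbC.
Qed.

Lemma Xmx0 k l i : Xmx k l i i = 0.
Proof. by rewrite !mxE [(i == l) && _]andbC subrr. Qed.

Definition so_set : set 'M[R]_m :=
  lspan [set A | exists i j, i != j /\ A = Xmx i j].

Record so := So { so_val : 'M[R]_m; _ : so_val \in so_set }.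

HB.instance Definition _ := [isSub for so_val].
HB.instance Definition _ := [Choice of so by <:].
HB.instance Definition _ :=
  GRing.SubChoice_isSubLmodule.Build R 'M[R]_m (mem so_set) so
    (lspan_submod _).

Lemma so_setP A :
  reflect ((forall i j, A j i = - A i j) /\ (forall i, A i i = 0))
          (A \in so_set).
Proof.
apply: (iffP idP) => [|[Aas A0]].
  rewrite inE => -[s Ss ->]; split=> [i j|i]; rewrite !summxE.
    rewrite -sumrN; apply: eq_big_seq => p /Ss[k [l [_ ->]]].
    by rewrite mxE XmxN mulrN [in RHS]mxE.
  rewrite big1_seq // => p /Ss[k [l [_ ->]]].
  by rewrite mxE Xmx0 mulr0.
rewrite inE.
exists [seq (A p.1 p.2, Xmx p.1 p.2) |
    p : 'I_m * 'I_m <- index_enum _ & (p.1 < p.2)%N].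
  move=> p /mapP[[i j]]; rewrite mem_filter /= => /andP[lt_ij _] ->.
  by exists i, j; split=> //; rewrite neq_ltn lt_ij.
rewrite big_map big_filter /=.
rewrite -(pair_big_dep predT (fun i j : 'I_m => (i < j)%N)
            (fun i j => A i j *: Xmx i j)) /=.
apply/matrixP=> a b; rewrite summxE.
have E (i : 'I_m) : (\sum_(j < m | (i < j)%N) A i j *: Xmx i j) a b =
    (if i == a then (if (a < b)%N then A a b else 0) else 0)
    - (if i == b then (if (b < a)%N then A b a else 0) else 0).
  rewrite summxE.
  under eq_bigr do rewrite !mxE mulrBr.
  rewrite sumrB; congr (_ - _).
    case: eqVneq => [->|ne]; last first.
      by apply: big1 => j _; rewrite mulr0.
    case: ifPn => ab; last first.
      apply: big1 => j aj; rewrite ?eqxx /=; case: eqVneq ab => [->|_ _].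
        by rewrite aj.
      by rewrite mulr0.
    rewrite (bigD1 b) //= !eqxx mulr1 big1 ?addr0 // => j /andP[_ jb].
    by rewrite [b == j]eq_sym (negPf jb) mulr0.
  case: eqVneq => [->|ne]; last first.
    by apply: big1 => j _; rewrite andbF mulr0.
  case: ifPn => ab; last first.
    apply: big1 => j aj; rewrite ?eqxx andbT; case: eqVneq ab => [->|_ _].
      by rewrite aj.
    by rewrite mulr0.
  rewrite (bigD1 a) //= !eqxx mulr1 big1 ?addr0 // => j /andP[_ jb].
  by rewrite [a == j]eq_sym (negPf jb) mulr0.
under eq_bigr do rewrite E.
rewrite sumrB -!big_mkcond !big_pred1_eq.
case: (ltngtP a b) => [||/val_inj ->]; first by rewrite subr0.
  by rewrite sub0r; move: (Aas a b) => ->; rewrite opprK.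
by rewrite A0 subr0.
Qed.

Definition so_idx := {p : 'I_m * 'I_m | (p.1 < p.2)%N}.

Definition so_coord (x : so) : 'rV[R]_#|{: so_idx}| :=
  \row_k so_val x (val (enum_val k)).1 (val (enum_val k)).2.

Lemma so_coord_linear : linear so_coord.
Proof. by move=> a x y; apply/rowP=> k; rewrite !mxE. Qed.

Lemma so_coord_bij : bijective so_coord.
Proof.
pose u (v : 'rV[R]_#|{: so_idx}|) (i j : 'I_m) : R :=
  oapp (fun p : so_idx => v 0 (enum_rank p)) 0 (insub (i, j)).
pose f v : 'M[R]_m := \matrix_(i, j) (u v i j - u v j i).
have u0 v (i j : 'I_m) : (j <= i)%N -> u v i j = 0.
  by move=> ji; rewrite /u insubN //= -leqNgt.
have fP v : f v \in so_set.
  by apply/so_setP; split=> [i j|i]; rewrite !mxE ?opprB ?subrr.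
exists (fun v => So (fP v)).
  move=> x; apply: val_inj; apply/matrixP => i j /=.
  have [Aas A0] := so_setP _ (valP x).
  have uE (a b : 'I_m) : (a < b)%N -> u (so_coord x) a b = so_val x a b.
    by move=> ab; rewrite /u insubT /= mxE enum_rankK.
  rewrite mxE; case: (ltngtP i j) => [ij|ji|/val_inj ->].
  - by rewrite uE // u0 ?subr0 // ltnW.
  - by rewrite u0 1?ltnW // uE // sub0r Aas opprK.
  - by rewrite subrr A0.
move=> v; apply/rowP=> k; rewrite !mxE.
rewrite (u0 _ _ _ (ltnW (valP (enum_val k)))) subr0 /u -surjective_pairing.
by rewrite valK /= enum_valK.
Qed.

HB.instance Definition _ := Lmodule_hasFinDim.Build R so
  (exist2 _ _ so_coord so_coord_linear so_coord_bij).

Lemma so_lie_subproof (x y : so) :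
  so_val x *m so_val y - so_val y *m so_val x \in so_set.
Proof.
have /so_setP[xN _] := valP x; have /so_setP[yN _] := valP y.
have E i j : (so_val x *m so_val y) i j = (so_val y *m so_val x) j i.
  by rewrite !mxE; apply: eq_bigr => k _; rewrite xN yN mulrNN mulrC.
apply/so_setP; split=> [i j|i]; rewrite !mxE -?[\sum__ _]mxE; last first.
  by have := E i i; rewrite !mxE => ->; rewrite subrr.
by have := E i j; have := E j i; rewrite !mxE => -> ->; rewrite opprB.
Qed.

Definition so_lie (x y : so) : so := So (so_lie_subproof x y).

Fact so_lie_linearl y : linear (so_lie^~ y).
Proof.
move=> a x z; apply: val_inj; rewrite /= mulmxDl mulmxDr -scalemxAl -scalemxAr.
by rewrite scalerBr opprD addrACA.
Qed.

Fact so_lie_linearr x : linear (so_lie x).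
Proof.
move=> a y z; apply: val_inj; rewrite /= mulmxDl mulmxDr -scalemxAl -scalemxAr.
by rewrite scalerBr opprD addrACA.
Qed.

Fact so_liexx x : so_lie x x = 0.
Proof. by apply: val_inj; rewrite /= subrr. Qed.

Fact so_lie_jacobi x y z :
  so_lie x (so_lie y z) + so_lie y (so_lie z x) + so_lie z (so_lie x y) = 0.
Proof.
apply: val_inj; rewrite /= !mulmxBr !mulmxBl !mulmxA.
do 6![move: (_ *m _ *m _) => ?].
by apply/matrixP => i j; rewrite !mxE; ring.
Qed.

HB.instance Definition _ := Vector_isLie.Build R so
  so_lie_linearl so_lie_linearr so_liexx so_lie_jacobi.

Lemma Xmx_so i j : Xmx i j \in so_set.
Proof.
by apply/so_setP; split=> [k l|k]; [exact: XmxN|exact: Xmx0].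
Qed.

Definition soX (i j : 'I_m) : so := So (Xmx_so i j).

Definition edge_set : {set {set 'I_m}} :=
  [set [set p.1; p.2] | p : 'I_m * 'I_m & p.1 != p.2]%SET.

Definition so_edge_span (E : {set {set 'I_m}}) : set so :=
  lspan [set x | exists i j, [set i; j]%SET \in E /\ x = soX i j].

End SpecialOrthogonal.

Arguments so_edge_span R {m} E.

(* Main.v *)
Require Import Defs.
From HB Require Import structures.
From mathcomp Require Import classical_sets.
From mathcomp Require Import all_boot all_order all_algebra.

Set Implicit Arguments.
Unset Strict Implicit.
Unset Printing Implicit Defensive.

Import GRing.Theory VectorInternalTheory.
Local Open Scope ring_scope.

(* An element of H_k is a skew-symmetric matrix supported on the edges of M_k.*)
(* M_k being a perfect matching, let a |-> a' be the involution it defines.   *)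
(* Two matrices supported on M_k commute because the off-diagonal entries of  *)
(* their product vanish.  If A normalizes H_k and {a,b} is not in M_k, then   *)
(* the (a',b) entry of [A, X_(a,a')] is A_(a,b), hence A_(a,b) = 0.           *)
(* Finally, for i < j the X_(i,j)-coordinate of [x,[y,X_(i,j)]] is            *)
(* (xy)_(i,i) + (yx)_(j,j) + 2 x_(i,j) y_(i,j), and each of the three terms   *)
(* vanishes when x and y are supported on disjoint sets of edges; so the      *)
(* trace defining the Killing form is a sum of zeros.                         *)

(** [so_edge_spanP] turns each [H_k] into a support condition, so every claim is checked on matrix
    entries. Each edge lies in exactly one [M k], so cutting a matrix along the supports gives the
    direct sum ([so_edge_span_direct_sum]). The matching property gives [so_edge_span_abelian] and
    [so_edge_span_cartan]; disjointness of edge sets gives [killing_orthogonal]. Two counts supply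
    the combinatorics: n(2n-1) edges make the blocks distinct, and n disjoint pairs cover all 2n
    vertices. *)

HB.instance Definition _ (R : comNzRingType) (L : lieAlgType R) (x : L) :=
  GRing.isLinear.Build R L L *:%R (lie x) (lie_linearr x).

HB.instance Definition _ (R : comNzRingType) (m : nat) :=
  GRing.isLinear.Build R (so R m) 'rV[R]_#|{: so_idx m}| *:%R (@so_coord R m)
    (@so_coord_linear R m).

(* v2r is opaque, so the basis underlying f2mx is not accessible. *)
Lemma mxtrace_f2mx (R : comNzRingType) (L : vectType R) (d : nat)
    (c : {linear L -> 'rV[R]_d}) (b : 'I_d -> L) (f : 'End(L)) :
    (forall x, x = \sum_k c x 0 k *: b k) ->
  \tr (f2mx f) = \sum_k c (f (b k)) 0 k.
Proof.
move=> cK.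
pose B := \matrix_k v2r (b k).
pose C := lin1_mx (c \o r2v).
(* This is the expansion [cK] in matrix form. With F the matrix of [f], it gives tr F = tr (C B F) =
   tr (B F C), and row k of B F C is [c (f (b k))]. *)
have CB : C *m B = 1%:M.
  apply/row_matrixP => i; rewrite row_mul row1 rowE /C mul_rV_lin1 /=.
  set e := delta_mx 0 i.
  rewrite -[RHS](r2vK e).
  rewrite [X in _ = v2r X]cK linear_sum mulmx_sum_row.
  by apply: eq_bigr => k _; rewrite linearZ rowK.
rewrite -[f2mx f]mul1mx -CB -mulmxA mxtrace_mulC.
apply: eq_bigr => k _.
transitivity (row k (B *m f2mx f *m C) 0 k).
  by rewrite [RHS]mxE.
by rewrite !row_mul rowK /C mul_rV_lin1 /= [in RHS]unlock.
Qed.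

(** * Supports of skew-symmetric matrices, direct sum, Killing form *)

Section SoEntries.
Variables (R : comNzRingType) (m : nat).
Implicit Types (x y : so R m) (E F : {set {set 'I_m}}).

Lemma so_val_skew x i j : so_val x j i = - so_val x i j.
Proof. by have /so_setP[] := valP x. Qed.

Lemma so_val_diag x i : so_val x i i = 0.
Proof. by have /so_setP[] := valP x. Qed.

Lemma so_val_sum I (r : seq I) (P : pred I) (f : I -> so R m) i j :
  so_val (\sum_(k <- r | P k) f k) i j = \sum_(k <- r | P k) so_val (f k) i j.
Proof. by rewrite -[so_val _]/(val _) raddf_sum summxE. Qed.

Lemma so_sum_soX x :
  x = \sum_k so_coord x 0 k *:
        soX R (val (enum_val k)).1 (val (enum_val k)).2.
Proof.
apply: (bij_inj (so_coord_bij R m)); apply/rowP => l.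
rewrite linear_sum summxE (bigD1 l) //= big1 => [|k kl].
  rewrite linearZ !mxE !eqxx /=.
  case: (enum_val l) => -[a b] /= ab.
  by rewrite (gtn_eqF ab : (b == a) = false) andbF subr0 mulr1 addr0.
rewrite linearZ !mxE.
have : enum_val k != enum_val l by apply: contra kl => /eqP/enum_val_inj->.
case: (enum_val k) (enum_val l) => -[a b] /= ab [[a' b'] /= ab'].
rewrite -val_eqE /= xpair_eqE => ne.
rewrite [a' == a]eq_sym [b' == b]eq_sym (negPf ne).
case: eqVneq => [eba|_]; last by rewrite subrr mulr0.
case: eqVneq => [eab|_]; last by rewrite andbF subrr mulr0.
by move: ab'; rewrite eba eab ltnNge ltnW.
Qed.

Lemma so_edge_spanP E x :
  so_edge_span R E x <->
  (forall i j, [set i; j] \notin E -> so_val x i j = 0).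
Proof.
split=> [[s sE ->] i j ijE|xE].
  rewrite so_val_sum big1_seq // => p /andP[_ /sE[a [b [abE ->]]]].
  rewrite /= !mxE.
  have /negPf-> : ~~ ((i == a) && (j == b)).
    by apply: contra ijE => /andP[/eqP-> /eqP->].
  have /negPf-> : ~~ ((i == b) && (j == a)).
    by apply: contra ijE => /andP[/eqP-> /eqP->]; rewrite setUC.
  by rewrite subrr mulr0.
(* Expand [x] in the basis X_(i,j), i < j, and keep the terms on edges of [E]; the dropped
   coordinates vanish by [xE]. *)
pose e (k : 'I_#|{: so_idx m}|) := val (enum_val k).
exists [seq (so_coord x 0 k, soX R (e k).1 (e k).2)
          | k <- enum 'I_#|{: so_idx m}| & [set (e k).1; (e k).2] \in E].
  move=> p /mapP[k]; rewrite mem_filter => /andP[kE _] ->.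
  by exists (e k).1, (e k).2.
rewrite big_map big_filter big_enum_cond [LHS]so_sum_soX [RHS]big_mkcond /=.
apply: eq_bigr => k _; case: ifPn => // /xE kE.
by rewrite mxE kE scale0r.
Qed.

Lemma so_edge_span_submod E : submod_closed (mem (so_edge_span R E)).
Proof.
split=> [|a x y]; rewrite !in_setE.
  by apply/so_edge_spanP => i j _; rewrite /= mxE.
move=> /so_edge_spanP xE /so_edge_spanP yE; apply/so_edge_spanP => i j ijE.
by rewrite /= !mxE xE // yE // mulr0 addr0.
Qed.

Lemma so_lieE x y i j :
  so_val (lie x y) i j = \sum_k so_val x i k * so_val y k j
                         - \sum_k so_val y i k * so_val x k j.
Proof. by rewrite /= !mxE. Qed.

Fact so_restrict_subproof E x :
  \matrix_(i, j) (if [set i; j] \in E then so_val x i j else 0)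
    \in @so_set R m.
Proof.
apply/so_setP; split=> [i j|i]; rewrite !mxE.
  by rewrite setUC; case: ifP => _; rewrite ?oppr0 // so_val_skew.
by rewrite so_val_diag if_same.
Qed.

(** The component of [x] in [so_edge_span R E]. *)
Definition so_restrict E x : so R m := So (so_restrict_subproof E x).

Lemma so_edge_span_direct_sum (d : nat) (M : 'I_d -> {set {set 'I_m}}) :
    (forall i j, i != j -> exists k, [set i; j] \in M k) ->
    (forall (e : {set 'I_m}) k l, e \in M k -> e \in M l -> k = l) ->
  direct_sum_decomposition (fun k => so_edge_span R (M k)).
Proof.
move=> Mcov Minj x.
exists [ffun k => so_restrict (M k) x]; split=> [|h [hM ->]].
  split=> [k|].
    by rewrite ffunE; apply/so_edge_spanP => i j /negPf ijM; rewrite mxE ijM.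
  apply: val_inj; apply/matrixP => i j; rewrite so_val_sum.
  have [->|/Mcov[k ijk]] := eqVneq i j.
    by rewrite so_val_diag big1 // => k _; rewrite so_val_diag.
  rewrite (bigD1 k) //= ffunE mxE ijk big1 ?addr0 // => l lk.
  rewrite ffunE mxE; case: ifP => // ijl.
  by rewrite (Minj _ _ _ ijk ijl) eqxx in lk.
(* Uniqueness: at an edge of [M k], only [h k] contributes to the sum. *)
apply/ffunP => k; rewrite ffunE; apply: val_inj; apply/matrixP => i j.
rewrite mxE so_val_sum; case: ifPn => ijk; last first.
  by have /so_edge_spanP-> := hM k.
rewrite (bigD1 k) //= big1 ?addr0 // => l lk.
have /so_edge_spanP-> // := hM l.
by apply: contra lk => ijl; rewrite (Minj _ _ _ ijk ijl).
Qed.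

(** The trace is taken in the basis X_(i,j), i < j, whose coordinates are the upper triangular
    entries. *)
Lemma killing_so x y :
  killing x y =
  \sum_(p : so_idx m)
    let: (i, j) := val p in so_val (lie x (lie y (soX R i j))) i j.
Proof.
rewrite /killing (mxtrace_f2mx _ so_sum_soX).
rewrite [RHS](reindex_onto enum_val enum_rank); last first.
  by move=> p _; rewrite enum_rankK.
apply: eq_big => [k|k _]; first by rewrite enum_valK eqxx.
by rewrite comp_lfunE !lfunE [LHS]mxE; case: (\val (enum_val k)).
Qed.

Lemma so_val_lie_soX y a b i j :
  so_val (lie y (soX R a b)) i j =
    so_val y i a *+ (j == b) - so_val y i b *+ (j == a)
    - (so_val y b j *+ (i == a) - so_val y a j *+ (i == b)).
Proof.
have E (c : 'I_m) (d : bool) (z : 'I_m -> R) :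
    \sum_k z k * ((k == c) && d)%:R = z c *+ d.
  rewrite (bigD1 c) //= eqxx big1 ?addr0 => [|k /negPf->]; last exact: mulr0.
  by rewrite mulr_natr.
rewrite so_lieE; congr (_ - _).
  under eq_bigr do rewrite !mxE mulrBr.
  by rewrite sumrB !E.
under eq_bigr do rewrite !mxE mulrC mulrBr andbC [(i == b) && _]andbC.
by rewrite sumrB !E.
Qed.

Lemma killing_orthogonal E F x y :
    (forall e : {set 'I_m}, e \in E -> e \notin F) ->
  so_edge_span R E x -> so_edge_span R F y -> killing x y = 0.
Proof.
move=> EF /so_edge_spanP xE /so_edge_spanP yF.
have xy0 i j k l : [set i; j] = [set k; l] -> so_val x i j * so_val y k l = 0.
  move=> ijkl; have [/EF|/xE->] := boolP ([set i; j] \in E); last exact: mul0r.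
  by rewrite ijkl => /yF->; rewrite mulr0.
rewrite killing_so big1 // => -[[i j] lt_ij] _.
have /negPf neq_ij : i != j by rewrite neq_ltn (lt_ij : (i < j)%N).
rewrite -[LHS]/(so_val (lie x (lie y (soX R i j))) i j).
rewrite so_lieE !big1 ?subr0 // => k _; rewrite so_val_lie_soX; last first.
  (* The (k,j) entry of [y, X_(i,j)] is [y k i + y i j *+ (k == j)]; multiplied by [x i k], both
     terms pair [x] and [y] on one common edge. *)
  rewrite [j == i]eq_sym neq_ij !eqxx so_val_diag mul0rn !mulr0n mulr1n.
  rewrite subr0 sub0r opprK mulrDr xy0 1?setUC // add0r.
  by case: eqVneq => [->|_]; rewrite ?mulr0 // mulr1n xy0.
(* Likewise the (i,k) entry is [- y i j *+ (k == i) - y j k], multiplied by [x k j]. *)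
rewrite neq_ij !eqxx so_val_diag mul0rn !mulr0n mulr1n subr0 sub0r.
rewrite mulrDl !mulNr ![_ * so_val x _ _]mulrC xy0 1?setUC // oppr0 addr0.
by case: eqVneq => [->|_]; rewrite ?mulr0 ?oppr0 // mulr1n xy0 ?oppr0.
Qed.

End SoEntries.

(** * The span of a perfect matching is an abelian Cartan subalgebra *)

Section PerfectMatching.
Variables (R : comNzRingType) (m : nat) (E : {set {set 'I_m}}).
Hypothesis E_disj : forall i j k : 'I_m,
  [set i; j] \in E -> [set i; k] \in E -> j = k.
Implicit Types x y : so R m.

Lemma so_edge_span_abelian : lie_abelian (so_edge_span R E).
Proof.
move=> x y /so_edge_spanP xE /so_edge_spanP yE.
have xy0 (z t : so R m) (i j k : 'I_m) :
    (forall i j, [set i; j] \notin E -> so_val z i j = 0) ->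
    (forall i j, [set i; j] \notin E -> so_val t i j = 0) ->
  i != j -> so_val z i k * so_val t k j = 0.
  move=> zE tE ij; have [ik|/zE->] := boolP ([set i; k] \in E); last first.
    exact: mul0r.
  have [kj|/tE->] := boolP ([set k; j] \in E); last exact: mulr0.
  (* Both [i] and [j] would be the partner of [k]. *)
  by rewrite setUC in ik; rewrite (E_disj ik kj) eqxx in ij.
apply: val_inj; apply/matrixP => i j; rewrite [RHS]mxE.
have [->|ij] := eqVneq i j; first exact: so_val_diag.
by rewrite so_lieE !big1 ?subr0 // => k _; apply: xy0.
Qed.

Lemma so_edge_span_nilpotent : lie_nilpotent (so_edge_span R E).
Proof.
have [E0 _] := so_edge_span_submod R E; rewrite in_setE in E0.
exists 1%N; apply/seteqP; split=> [x [s sE ->]|x ->] /=.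
  rewrite big1_seq // => p /andP[_ /sE[y yE [z zE <-]]].
  by rewrite so_edge_span_abelian // scaler0.
by apply: mem_lspan; exists 0 => //; exists 0 => //; rewrite liexx.
Qed.

Hypothesis E_cover : forall i, exists2 j, i != j & [set i; j] \in E.

Lemma so_edge_span_cartan : is_cartan (so_edge_span R E).
Proof.
have submodE := so_edge_span_submod R E.
have [E0 _] := submodE; rewrite in_setE in E0.
split=> [||].
- by split=> // x y xE yE; rewrite so_edge_span_abelian.
- exact: so_edge_span_nilpotent.
apply/seteqP; split=> x => [xE y yE|xN].
  by rewrite so_edge_span_abelian.
apply/so_edge_spanP => a b abE; have [a' aa' aa'E] := E_cover a.
have [->|ab] := eqVneq a b; first exact: so_val_diag.
have a'b : a' != b by apply: contra abE => /eqP<-.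
(* The only partner of [a'] is [a], so elements of the span vanish at (a',b). *)
have a'bE : [set a'; b] \notin E.
  rewrite setUC in aa'E.
  by apply: contra ab => a'bE; rewrite (E_disj aa'E a'bE).
have XE : so_edge_span R E (soX R a a') by apply: mem_lspan; exists a, a'.
have /so_edge_spanP/(_ _ _ a'bE) := xN _ XE.
rewrite so_val_lie_soX eqxx [b == a']eq_sym [b == a]eq_sym [a' == a]eq_sym.
rewrite (negPf a'b) (negPf ab) (negPf aa') !mulr0n !mulr1n.
by rewrite subrr !sub0r opprK.
Qed.

End PerfectMatching.

(** * Counting in the 1-factorization *)

Lemma edge_setE (m : nat) : edge_set m = [set e : {set 'I_m} | #|e| == 2].
Proof.
apply/setP => e; rewrite inE; apply/imsetP/cards2P => [[[i j]]|[i [j [ij ->]]]].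
  by rewrite inE => /= ij ->; exists i, j.
by exists (i, j); rewrite ?inE.
Qed.

Theorem theorem4p2 (R : finComNzRingType)
  (c : nat) (char_R : is_char R c) (odd_c : odd c)
  (n : nat) (n_gt0 : (0 < n)%N)
  (M : 'I_(2 * n - 1) -> {set {set 'I_(2 * n)}})
  (partM : partition [set M k | k : 'I_(2 * n - 1)] (edge_set (2 * n)))
  (cardM : forall k, #|M k| = n)
  (disjM : forall k (alpha beta : {set 'I_(2 * n)}),
     alpha \in M k -> beta \in M k -> alpha != beta -> alpha :&: beta = set0) :
  is_ODAC (L := so R (2 * n))
    (fun k : 'I_(2 * n - 1) => so_edge_span R (M k)).
Proof.
have M2 k e : e \in M k -> #|e| = 2.
  move=> ek; apply/eqP; have : e \in edge_set (2 * n).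
    by rewrite -(cover_partition partM); apply/bigcupP; exists (M k) => //;
       apply: imset_f.
  by rewrite edge_setE inE.
(* [partM] concerns the set of blocks, which by itself does not exclude [M k = M l]. Blocks of size
   n partition n(2n-1) edges, so there are 2n-1 distinct ones. *)
have M_inj : injective M.
  suff /imset_injP : #|[set M k | k : 'I_(2 * n - 1)]| == #|'I_(2 * n - 1)|.
    by move=> inj k l; apply: inj.
  rewrite card_ord -(eqn_pmul2r n_gt0); apply/eqP.
  transitivity #|edge_set (2 * n)|.
    apply/esym; apply: card_uniform_partition partM.
    by move=> _ /imsetP[k _ ->].
  rewrite edge_setE card_draws card_ord bin2 -subn1 -mulnA mul2n doubleK.
  by rewrite mulnC.
have M_disj (e : {set 'I_(2 * n)}) k l : e \in M k -> e \in M l -> k = l.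
  have /and3P[_ /trivIsetP triv _] := partM => ek el.
  apply: M_inj; apply/eqP/negPn/negP => kl.
  have Mimg i : M i \in [set M k | k : 'I_(2 * n - 1)] by apply: imset_f.
  have := triv _ _ (Mimg k) (Mimg l) kl.
  by move/disjointFr => /(_ _ ek); rewrite el.
have M_edge k (i j l : 'I_(2 * n)) :
    [set i; j] \in M k -> [set i; l] \in M k -> j = l.
  move=> ij il; apply/eqP/negPn/negP => jl.
  have := cards2 i j; rewrite (M2 _ _ ij); case: eqVneq => // neq_ij _.
  (* Distinct edges of [M k] are disjoint, yet both contain [i]. *)
  have /(disjM _ _ _ ij il)/setP/(_ i) : [set i; j] != [set i; l].
    apply: contraNneq jl => /setP/(_ j).
    by rewrite !inE eqxx orbT eq_sym (negPf neq_ij).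
  by rewrite !inE eqxx.
have M_cover k (i : 'I_(2 * n)) : exists2 j, i != j & [set i; j] \in M k.
  have trivM : trivIset (M k).
    apply/trivIsetP => A B Ak Bk AB.
    by rewrite -setI_eq0; apply/eqP; exact: (disjM k).
  (* The n disjoint pairs of [M k] contain 2n vertices, hence all of them. *)
  have coverM : cover (M k) = setT.
    apply/eqP; rewrite eqEcard subsetT cardsT card_ord.
    rewrite -(eqP trivM) (eq_bigr (fun=> 2%N)) => [|e /M2 //].
    by rewrite sum_nat_const cardM mulnC leqnn.
  have : i \in cover (M k) by rewrite coverM inE.
  case/bigcupP => e ek; have /eqP/cards2P[a [b [ab e_ab]]] := M2 _ _ ek.
  move: ek; rewrite e_ab !inE => abk /orP[/eqP->|/eqP->]; first by exists b.
  by exists a; rewrite 1?eq_sym // setUC.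
split.
- apply: so_edge_span_direct_sum => // i j ij.
  have : [set i; j] \in edge_set (2 * n).
    by rewrite edge_setE inE cards2 ij.
  rewrite -(cover_partition partM) => /bigcupP[_ /imsetP[k _ ->] ijk].
  by exists k.
- by move=> k; apply: so_edge_span_cartan (M_edge k) (M_cover k).
- by move=> k; apply: so_edge_span_abelian (M_edge k).
- move=> k l kl x y; apply: killing_orthogonal => e ek.
  by apply: contra kl => el; rewrite (M_disj _ _ _ ek el).
Qed.
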